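(* Partition the parameter vector as $\theta = (\alpha, z)^T$, and let $V$, $H$ and $\hat\Sigma = (I - VH)^{-1}V$ be partitioned correspondingly, e.g. $V = \begin{pmatrix} V_\alpha & V_{\alpha z}\\ V_{z\alpha} & V_z\end{pmatrix}$, $H = \begin{pmatrix} H_\alpha & H_{\alpha z}\\ H_{z\alpha} & H_z\end{pmatrix}$. Assume the mean-field factorization $q(\alpha,z) = q(\alpha)q(z)$ (so that $V_{\alpha z} = 0$ and $V_{z\alpha}=0$), and that $I - VH$ and $I_z - V_zH_z$ are invertible. Then the $\alpha$-block of $\hat\Sigma$ is $$\hat\Sigma_\alpha = \left(I_\alpha - V_\alpha H_\alpha - V_\alpha H_{\alpha z}\,(I_z - V_zH_z)^{-1}\,V_zH_{z\alpha}\right)^{-1}V_\alpha,$$ where $I_\alpha$ and $I_z$ are identity matrices of the sizes of $\alpha$ and $z$ respectively.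
   Context: $q(\theta\mid\eta)$ is an exponential-family variational distribution, $\log q(\theta\mid\eta) = \eta^T\theta - A(\eta)$, parameterized by its mean $m = \mathbb{E}_q[\theta]$; $q^*$, with mean $m^*$, is a local optimum of the variational objective $E(m) = L(m) + S(m)$, with $L = \mathbb{E}_q[\log p(\theta\mid x)]$ and $S = -\mathbb{E}_q[\log q(\theta)]$, for a given posterior density $p(\theta\mid x)$. $V := \mathrm{Cov}_{q^*}(\theta)$ is the covariance matrix of $\theta$ under $q^*$ and $H := \frac{\partial^2 L}{\partial m\,\partial m^T}\big|_{m=m^*}$. The matrix $\hat\Sigma = (I - VH)^{-1}V$ is called the linear response variational Bayes (LRVB) covariance estimate. *)

(* Defs.v *)
From mathcomp Require Import all_boot all_order all_algebra.
From mathcomp Require Import all_classical all_reals all_analysis.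

Set Implicit Arguments.
Unset Strict Implicit.
Unset Printing Implicit Defensive.

Import Order.TTheory GRing.Theory Num.Theory.
Import numFieldNormedType.Exports.

Local Open Scope classical_set_scope.
Local Open Scope ring_scope.

(** theta = (alpha, z) is kept as a pair of tuples because the library puts the
    Borel sigma-algebra of R^k on tuples and none on matrices; [theta] is the
    associated column vector. *)
Notation params R k l := (k.-tuple R * l.-tuple R)%type.

Definition theta (R : realType) (k l : nat) (t : params R k l) :
    'cV[R]_(k + l) :=
  col_mx (\col_i tnth t.1 i) (\col_j tnth t.2 j).

Definition theta_coord (R : realType) (k l : nat) (i : 'I_(k + l))
    (t : params R k l) : R :=
  theta t i 0.

Definition mean_vec (R : realType) (k l : nat)
    (P : probability (params R k l) R) : 'cV[R]_(k + l) :=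
  \col_i fine 'E_P[theta_coord i].

Definition cov_mx (R : realType) (k l : nat)
    (P : probability (params R k l) R) : 'M[R]_(k + l) :=
  \matrix_(i, j) fine (covariance P (theta_coord i) (theta_coord j)).

Definition prob_density (R : realType) (k l : nat)
    (nu : {measure set (params R k l) -> \bar R}) (f : params R k l -> R) :
    Prop :=
  [/\ measurable_fun [set: params R k l] f,
      forall t, 0 <= f t &
      (\int[nu]_t (f t)%:E = 1)%E].

(** [Q eta] is the law with density [q eta] with respect to [nu].  The last
    clause is log q(theta | eta) = eta^T theta - A(eta); as [lne] is -oo on
    nonpositive reals, it forces q(theta | eta) > 0. *)
Definition exponential_family (R : realType) (k l : nat)
    (nu : {measure set (params R k l) -> \bar R})
    (Xi : set 'cV[R]_(k + l)) (A : 'cV[R]_(k + l) -> R)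
    (q : 'cV[R]_(k + l) -> params R k l -> R)
    (Q : 'cV[R]_(k + l) -> probability (params R k l) R) : Prop :=
  forall eta, Xi eta ->
    [/\ prob_density nu (q eta),
        forall B : set (params R k l), measurable B ->
          (Q eta B = \int[nu]_(t in B) (q eta t)%:E)%E &
        forall t,
          lne (q eta t)%:E = ((eta^T *m theta t) 0 0 - A eta)%:E].

(** q(alpha, z) = q(alpha) q(z), stated for the laws. *)
Definition mean_field (R : realType) (k l : nat)
    (P : probability (params R k l) R) : Prop :=
  exists (Pa : probability (k.-tuple R) R) (Pz : probability (l.-tuple R) R),
    forall B : set (params R k l), measurable B -> P B = (Pa \x Pz)%E B.

Definition expected_log (R : realType) (k l : nat)
    (P : probability (params R k l) R) (f : params R k l -> R) : R :=
  fine (\int[P]_t lne (f t)%:E)%E.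

(** [eta_of] sends a mean m to the natural parameter of the member of the
    family with mean m, so that L, S and E below are functions of m. *)
Definition vb_L (R : realType) (k l : nat) (p : params R k l -> R)
    (Q : 'cV[R]_(k + l) -> probability (params R k l) R)
    (eta_of : 'cV[R]_(k + l) -> 'cV[R]_(k + l)) (m : 'cV[R]_(k + l)) : R :=
  expected_log (Q (eta_of m)) p.

Definition vb_S (R : realType) (k l : nat)
    (q : 'cV[R]_(k + l) -> params R k l -> R)
    (Q : 'cV[R]_(k + l) -> probability (params R k l) R)
    (eta_of : 'cV[R]_(k + l) -> 'cV[R]_(k + l)) (m : 'cV[R]_(k + l)) : R :=
  - expected_log (Q (eta_of m)) (q (eta_of m)).

Definition vb_E (R : realType) (k l : nat) (p : params R k l -> R)
    (q : 'cV[R]_(k + l) -> params R k l -> R)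
    (Q : 'cV[R]_(k + l) -> probability (params R k l) R)
    (eta_of : 'cV[R]_(k + l) -> 'cV[R]_(k + l)) (m : 'cV[R]_(k + l)) : R :=
  vb_L p Q eta_of m + vb_S q Q eta_of m.

Definition pderiv (R : realType) (n : nat) (i : 'I_n) (f : 'cV[R]_n -> R)
    (m : 'cV[R]_n) : R :=
  'D_(delta_mx i 0) f m.

Definition hessian (R : realType) (n : nat) (f : 'cV[R]_n -> R)
    (m : 'cV[R]_n) : 'M[R]_n :=
  \matrix_(i, j) pderiv i (pderiv j f) m.

Definition twice_differentiable (R : realType) (n : nat) (f : 'cV[R]_n -> R)
    (m : 'cV[R]_n) : Prop :=
  (\forall x \near m, differentiable f x) /\
  (forall j, differentiable (pderiv j f) m).

Definition lrvb_cov (R : realType) (n : nat) (V H : 'M[R]_n) : 'M[R]_n :=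
  invmx (1%:M - V *m H) *m V.

(* Main.v *)
(** Under the mean-field factorization Fubini gives E[alpha_i z_j] =
    E[alpha_i] E[z_j], so V is block diagonal.  Then I - VH has blocks
    I - V_alpha H_alpha, - V_alpha H_(alpha z), - V_z H_(z alpha) and
    I - V_z H_z; the alpha-block of its inverse is the inverse of the Schur
    complement of the last block, and right multiplication by the block
    diagonal V multiplies that block by V_alpha. *)

Require Import Defs.
From mathcomp Require Import all_boot all_order all_algebra.
From mathcomp Require Import all_classical all_reals all_analysis.
From mathcomp Require Import measurable_realfun.

Set Implicit Arguments.
Unset Strict Implicit.
Unset Printing Implicit Defensive.

Import Order.TTheory GRing.Theory Num.Theory.
Import numFieldNormedType.Exports.

Local Open Scope classical_set_scope.
Local Open Scope ring_scope.

Section expectation_product.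
Local Open Scope ereal_scope.
Context d1 d2 (T1 : measurableType d1) (T2 : measurableType d2) (R : realType).
Variables (P1 : probability T1 R) (P2 : probability T2 R).

(** By Fubini the inner integral over [P2] is that of a constant, and [P2] has mass 1. *)
Lemma integral_product_fst (f : T1 -> \bar R) :
  (P1 \x P2).-integrable setT (f \o fst) ->
  \int[P1 \x P2]_z f z.1 = \int[P1]_x f x.
Proof.
move=> intf; rewrite -(integral12_prod_meas1 intf).
apply: eq_integral => x _ /=.
rewrite [LHS](integral_cst P2 measurableT (f x)) [X in _ * X](_ : _ = 1) ?mule1//.
exact: probability_setT.
Qed.

Lemma integral_product_snd (g : T2 -> \bar R) :
  (P1 \x P2).-integrable setT (g \o snd) ->
  \int[P1 \x P2]_z g z.2 = \int[P2]_y g y.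
Proof.
move=> intg; rewrite -(integral21_prod_meas1 intg).
apply: eq_integral => y _ /=.
rewrite [LHS](integral_cst P1 measurableT (g y)) [X in _ * X](_ : _ = 1) ?mule1//.
exact: probability_setT.
Qed.

(** Marginalizing the absolute value carries finiteness from the product to the factor. This is what
    later allows constants to be pulled out of the one-variable integrals. *)
Lemma integrable_product_fst (f : T1 -> R) : measurable_fun [set: T1] f ->
  (P1 \x P2).-integrable setT (EFin \o f \o fst) ->
  P1.-integrable setT (EFin \o f).
Proof.
move=> mf intf; apply/integrableP; split; first exact/measurable_EFinP.
rewrite -(integral_product_fst (f := fun x => `|(f x)%:E|)).
  by case/integrableP: intf.
exact: integrable_abse intf.
Qed.

Lemma integrable_product_snd (g : T2 -> R) : measurable_fun [set: T2] g ->
  (P1 \x P2).-integrable setT (EFin \o g \o snd) ->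
  P2.-integrable setT (EFin \o g).
Proof.
move=> mg intg; apply/integrableP; split; first exact/measurable_EFinP.
rewrite -(integral_product_snd (g := fun y => `|(g y)%:E|)).
  by case/integrableP: intg.
exact: integrable_abse intg.
Qed.

Lemma expectation_mul_product (P : probability (T1 * T2)%type R)
    (f : T1 -> R) (g : T2 -> R) :
  (forall B, measurable B -> P B = (P1 \x P2) B) ->
  measurable_fun [set: T1] f -> measurable_fun [set: T2] g ->
  f \o fst \in Lfun P 1 -> g \o snd \in Lfun P 1 ->
  ((f \o fst) * (g \o snd))%R \in Lfun P 1 ->
  'E_P[(f \o fst) * (g \o snd)] = 'E_P[f \o fst] * 'E_P[g \o snd].
Proof.
move=> PE mf mg.
move=> /Lfun1_integrable intf /Lfun1_integrable intg /Lfun1_integrable intfg.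
(* [P] agrees with the product measure only on measurable sets, so integrals and integrability are
   transferred before Fubini is applied. *)
have eqint (h : T1 * T2 -> \bar R) : \int[P]_z h z = \int[P1 \x P2]_z h z.
  by apply: eq_measure_integral => B mB _; exact: PE.
have toprod (h : T1 * T2 -> \bar R) :
    P.-integrable setT h -> (P1 \x P2).-integrable setT h.
  by move=> /integrableP[mh hoo]; apply/integrableP; split; rewrite -?eqint.
move: intf intg intfg => /toprod intf /toprod intg /toprod intfg.
rewrite unlock !eqint.
rewrite (integral_product_fst (f := EFin \o f))//.
rewrite (integral_product_snd (g := EFin \o g))//.
have intg2 : P2.-integrable setT (EFin \o g).
  exact: integrable_product_snd.
(* [integralZr] takes a real factor, so the finite integral of [g] is named as a real. *)
have [c cE] : exists c : R, \int[P2]_y (EFin \o g) y = c%:E.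
  by exists (fine (\int[P2]_y (EFin \o g) y)); rewrite fineK// integrable_fin_num.
have intf1 : P1.-integrable setT (EFin \o f).
  exact: integrable_product_fst.
rewrite -(integral12_prod_meas1 intfg) cE -integralZr//.
apply: eq_integral => x _.
rewrite /fubini_F /= -cE -integralZl//.
Qed.

End expectation_product.

(** The two coordinates depend on different factors of the product law. Square integrability makes
    each of them and their product integrable, as Fubini requires. *)
Lemma mean_field_covariance0 (R : realType) (k l : nat)
    (P : probability (params R k l) R) (i : 'I_k) (j : 'I_l) :
  mean_field P ->
  (forall i, theta_coord i \in Lfun P 2%:E) ->
  covariance P (theta_coord (lshift l i)) (theta_coord (rshift k j)) = 0%E.
Proof.
move=> [Pa [Pz PE]] L2.
have L1 i' : (theta_coord i' : params R k l -> R) \in Lfun P 1.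
  by apply: Lfun_subset12 (L2 i') => //; exact: fin_num_measure.
have fE : (theta_coord (lshift l i) : params R k l -> R) =
    (fun a : k.-tuple R => tnth a i) \o fst.
  by apply/funext => t; rewrite /theta_coord /theta col_mxEu mxE.
have gE : (theta_coord (rshift k j) : params R k l -> R) =
    (fun z : l.-tuple R => tnth z j) \o snd.
  by apply/funext => t; rewrite /theta_coord /theta col_mxEd mxE.
have L12 := Lfun2_mul_Lfun1 (L2 (lshift l i)) (L2 (rshift k j)).
rewrite covarianceE//.
move: (L1 (lshift l i)) (L1 (rshift k j)) L12; rewrite fE gE => Lf Lg Lfg.
rewrite (expectation_mul_product PE)//; [|exact: measurable_tnth..].
by rewrite subee// fin_numM// expectation_fin_num.
Qed.

Lemma cov_mx_mean_field (R : realType) (k l : nat)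
    (P : probability (params R k l) R) :
  mean_field P -> (forall i, theta_coord i \in Lfun P 2%:E) ->
  ursubmx (cov_mx P) = 0 /\ dlsubmx (cov_mx P) = 0.
Proof.
move=> mfP L2; split; apply/matrixP => i j; rewrite !mxE.
  by rewrite mean_field_covariance0.
by rewrite covarianceC mean_field_covariance0.
Qed.

(** Block elimination in the first block column of [M *m invmx M = 1%:M] yields [S *m X = 1%:M]; for
    square matrices a one-sided inverse suffices. *)
Lemma ulsubmx_schur (R : comUnitRingType) (k l : nat) (M : 'M[R]_(k + l)) :
  M \in unitmx -> drsubmx M \in unitmx ->
  let S := ulsubmx M - ursubmx M *m invmx (drsubmx M) *m dlsubmx M in
  S \in unitmx /\ ulsubmx (invmx M) = invmx S.
Proof.
move=> Mu Du S.
have := mulmxV Mu.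
rewrite -{1}[M]submxK -{1}[invmx M]submxK mulmx_block.
rewrite (scalar_mx_block _ _ (1 : R)) => /eq_block_mx[ul _ dl _].
set X := ulsubmx (invmx M) in ul dl *.
set Y := dlsubmx (invmx M) in ul dl.
(* The lower-left block equation is solved for [Y]. *)
have YE : Y = - (invmx (drsubmx M) *m (dlsubmx M *m X)).
  rewrite -mulmxN -[LHS]mul1mx -(mulVmx Du) -mulmxA; congr (_ *m _).
  by apply/eqP; rewrite -addr_eq0 addrC dl.
have SX : S *m X = 1%:M.
  by rewrite -ul YE mulmxN mulmxBl !mulmxA.
have [Su _] := mulmx1_unit SX.
by split => //; rewrite -[LHS]mul1mx -(mulVmx Su) -mulmxA SX mulmx1.
Qed.

Theorem mainTheorem2 (R : realType) (k l : nat)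
  (nu : {measure set (params R k l) -> \bar R})
  (Xi : set 'cV[R]_(k + l)) (A : 'cV[R]_(k + l) -> R)
  (q : 'cV[R]_(k + l) -> params R k l -> R)
  (Q : 'cV[R]_(k + l) -> probability (params R k l) R)
  (eta_of : 'cV[R]_(k + l) -> 'cV[R]_(k + l))
  (p : params R k l -> R)
  (etastar mstar : 'cV[R]_(k + l)) (V H : 'M[R]_(k + l))
  (hQ : exponential_family nu Xi A q Q)
  (hint : forall eta i, Xi eta -> theta_coord i \in Lfun (Q eta) 1)
  (heta : forall eta, Xi eta -> eta_of (mean_vec (Q eta)) = eta)
  (hp : prob_density nu p)
  (hlogp : forall eta, Xi eta ->
     (Q eta).-integrable setT (fun t => lne (p t)%:E))
  (hXi : Xi etastar)
  (hm : mstar = mean_vec (Q etastar))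
  (hdom : nbhs mstar [set mean_vec (Q eta) | eta in Xi])
  (hopt : \forall m \near mstar,
     vb_E p q Q eta_of m <= vb_E p q Q eta_of mstar)
  (hsq : forall i, theta_coord i \in Lfun (Q etastar) 2%:E)
  (hV : V = cov_mx (Q etastar))
  (hL : twice_differentiable (vb_L p Q eta_of) mstar)
  (hH : H = hessian (vb_L p Q eta_of) mstar)
  (hmf : forall eta, Xi eta -> mean_field (Q eta))
  (hinv : 1%:M - V *m H \in unitmx)
  (hinvz : 1%:M - drsubmx V *m drsubmx H \in unitmx) :
  [/\ ursubmx V = 0,
      dlsubmx V = 0,
      1%:M - ulsubmx V *m ulsubmx H
        - ulsubmx V *m ursubmx H
          *m invmx (1%:M - drsubmx V *m drsubmx H)
          *m drsubmx V *m dlsubmx H \in unitmx &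
      ulsubmx (lrvb_cov V H) =
        invmx (1%:M - ulsubmx V *m ulsubmx H
          - ulsubmx V *m ursubmx H
            *m invmx (1%:M - drsubmx V *m drsubmx H)
            *m drsubmx V *m dlsubmx H)
        *m ulsubmx V].
Proof.
have [Vur Vdl] : ursubmx V = 0 /\ dlsubmx V = 0.
  by rewrite hV; apply: cov_mx_mean_field => //; exact: hmf.
have VE : V = block_mx (ulsubmx V) 0 0 (drsubmx V).
  by rewrite -[LHS]submxK Vur Vdl.
have IVH : 1%:M - V *m H =
    block_mx (1%:M - ulsubmx V *m ulsubmx H) (- (ulsubmx V *m ursubmx H))
             (- (drsubmx V *m dlsubmx H)) (1%:M - drsubmx V *m drsubmx H).
  rewrite {1}VE -{1}[H]submxK mulmx_block !mul0mx !addr0 !add0r.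
  by rewrite (scalar_mx_block _ _ (1 : R)) opp_block_mx add_block_mx !add0r.
have := @ulsubmx_schur _ _ _ (1%:M - V *m H) hinv.
rewrite {1}IVH block_mxKdr => /(_ hinvz).
(* The numbered occurrences are the four blocks of the Schur complement; [invmx (1%:M - V *m H)]
   stays unexpanded to match [lrvb_cov]. *)
rewrite {1 2 3 4}IVH !(block_mxKul, block_mxKur, block_mxKdl, block_mxKdr).
rewrite mulNmx mulmxN mulNmx opprK !mulmxA => -[Su SE].
split => //.
rewrite -SE /lrvb_cov; set W := invmx _.
(* The upper-right block of [W] meets the zero lower-left block of [V], so only
   [ulsubmx W *m ulsubmx V] survives. *)
by rewrite -{1}[W]submxK [X in _ *m X]VE mulmx_block block_mxKul mulmx0 addr0.
Qed.
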